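(* Let $\mathbb{F}$ be a field with involution $\overline{\,\cdot\,}$, let $m,n\ge 1$, let $x,y\in\mathbb{F}^m$ and $z,w\in\mathbb{F}^n$ be column vectors with all entries nonzero, let $a,b\in\mathbb{F}\setminus\{0\}$, and let $$M=\left[\begin{array}{cc|cc}0&x^T&a&0\\ y&0&0&0\\ \hline b&0&0&z^T\\ 0&0&w&0\end{array}\right]$$ (a square matrix of order $m+n+2$). Assume $x^Ty=z^Tw=0$, that $M^\dagger$ exists and that $M$ is core EP invertible (equivalently, the scalars $s=x^*x$, $u=y^*y$, $t=z^*z$, $v=w^*w$, $r=a\overline{a}+w^*w$, $h=b\overline{b}+y^*y$ are all nonzero). Then the MPCEP inverse of $M$ is $$M^{\dagger,\mathrm{cEP}}=\left[\begin{array}{cc|cc}0&h^{-1}y^*&\overline{b}h^{-1}&0\\ 0&0&0&0\\ \hline \overline{a}r^{-1}&0&0&r^{-1}w^*\\ 0&0&0&0\end{array}\right].$$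
   Context: For a matrix $A=[a_{ij}]$ over a field $\mathbb{F}$ with involution $\overline{\,\cdot\,}$ (a field automorphism with $\overline{\overline{c}}=c$), $\overline{A}=[\overline{a_{ij}}]$ and $A^*=\overline{A}^{\,T}$. All $4\times4$ block matrices have rows and columns partitioned with sizes $1,m,1,n$; each $0$ is a zero block of the appropriate size. Matrices $M$ of the displayed form are the matrices whose associated digraph is a double star digraph, in canonical form. The Moore–Penrose inverse $A^\dagger$ is the unique $X$ (if it exists) with $AXA=A$, $XAX=X$, $(AX)^*=AX$, $(XA)^*=XA$. A square matrix $A$ is core EP invertible if there is $X$ with $XA^{k+1}=A^k$ for some nonnegative integer $k$, $AX^2=X$, $(AX)^*=AX$; such $X$ is unique, called the core EP inverse and denoted $A^{\mathrm{cEP}}$. When $A^\dagger$ and $A^{\mathrm{cEP}}$ exist, the MPCEP (Moore–Penrose–core EP) inverse of $A$ is the unique $X$ with $XAX=X$, $AX=AA^{\mathrm{cEP}}$, $XA=A^\dagger AA^{\mathrm{cEP}}A$; explicitly $A^{\dagger,\mathrm{cEP}}=A^\dagger AA^{\mathrm{cEP}}$. *)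

(* Defs.v *)
From HB Require Import structures.
From mathcomp Require Import all_boot all_order all_algebra.

Set Implicit Arguments.
Unset Strict Implicit.
Unset Printing Implicit Defensive.

Import GRing.Theory.

Local Open Scope ring_scope.
Local Open Scope sesquilinear_scope.

(* A ^t theta is the conjugate transpose A^* for the involution theta. *)

Definition is_mpinv (F : fieldType) (theta : involutive_rmorphism F)
    (p q : nat) (A : 'M[F]_(p, q)) (X : 'M[F]_(q, p)) : Prop :=
  [/\ A *m X *m A = A, X *m A *m X = X,
      (A *m X) ^t theta = A *m X & (X *m A) ^t theta = X *m A].

Definition is_cepinv (F : fieldType) (theta : involutive_rmorphism F)
    (p : nat) (A X : 'M[F]_p) : Prop :=
  [/\ exists k : nat, X *m A ^+ k.+1 = A ^+ k,
      A *m (X *m X) = X & (A *m X) ^t theta = A *m X].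

Definition mp_invertible (F : fieldType) (theta : involutive_rmorphism F)
    (p q : nat) (A : 'M[F]_(p, q)) : Prop :=
  exists X, is_mpinv theta A X.

Definition cep_invertible (F : fieldType) (theta : involutive_rmorphism F)
    (p : nat) (A : 'M[F]_p) : Prop :=
  exists X, is_cepinv theta A X.

(* P and C are unique when they exist, so they stand for the Moore-Penrose
   inverse and the core EP inverse of A. *)
Definition is_mpcepinv (F : fieldType) (theta : involutive_rmorphism F)
    (p : nat) (A X : 'M[F]_p) : Prop :=
  exists P C : 'M[F]_p,
    [/\ is_mpinv theta A P, is_cepinv theta A C, X *m A *m X = X,
        A *m X = A *m C & X *m A = P *m A *m C *m A].

Definition star_sq (F : fieldType) (theta : involutive_rmorphism F)
    (k : nat) (x : 'cV[F]_k) : F := (x ^t theta *m x) 0 0.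

Definition double_star_mx (F : fieldType) (m n : nat) (a b : F)
    (x y : 'cV[F]_m) (z w : 'cV[F]_n) : 'M[F]_((1 + m) + (1 + n)) :=
  block_mx (block_mx 0 x^T y 0) (block_mx a%:M 0 0 0)
           (block_mx b%:M 0 0 0) (block_mx 0 z^T w 0).

(* Main.v *)
Require Import Defs.
From HB Require Import structures.
From mathcomp Require Import all_boot all_order all_algebra.

(** The MPCEP inverse of a matrix A equals P (A C), where P is its
    Moore-Penrose inverse and C its core EP inverse (mpcepinvE), and A C is the
    Hermitian projection onto the core of A, the stable range of its powers.
    Everything about the double star matrix M can be read off from its action
    on a few vectors, written below by their four blocks as columns
    (c; u; d; v).

    Put p = (a; 0; 0; w) and q = (0; y; b; 0).  Since x^T y = z^T w = 0, the
    matrix M swaps p and q up to the nonzero scalars a and b: M p = a q and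
    M q = b p.  Moreover the range of M^2 is contained in the span of p and q,
    so this span is the core of M.  The vectors p and q are orthogonal with
    p^* p = r and q^* q = h; hence, when r and h are nonzero, the projection
    onto the core is r^-1 p p^* + h^-1 q q^*, and composing it with the inverse
    of M on the core gives the core EP inverse (cepinv_two_cycle).

    The column space of M is spanned by the two unit vectors of the centres and
    by y and w in the leaf blocks; these four are pairwise orthogonal, and
    likewise the row space with x and z in place of y and w.  So an explicit
    Moore-Penrose inverse P exists when s, u, t, v are nonzero
    (double_star_mpinvP).  Let e and f be the unit vectors of the first and
    second centre.  As M e = q and M f = p, and e and f are fixed by the
    projection P M (their adjoints lie in the row space), P q = e and P p = f.
    Therefore composing P with the projection onto the core gives
    r^-1 f p^* + h^-1 e q^*, which is the displayed matrix.

    Conversely each scalar must be nonzero for the inverses to exist.  If A X is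
    Hermitian and fixes a vector k, then k^* = k^* A X, so k vanishes as soon as
    k^* A = 0 (mp_isotropic_eq0) or, for a vector of the core, as soon as
    k^* A^2 = 0 (cep_isotropic_eq0).  This applies to y and w in the leaf
    blocks when u or v is zero, to p and q when r or h is zero, and to x and z
    after transposing M. *)

Set Implicit Arguments.
Unset Strict Implicit.
Unset Printing Implicit Defensive.

Import GRing.Theory.

Local Open Scope ring_scope.
Local Open Scope sesquilinear_scope.

(** * Moore-Penrose, core EP and MPCEP inverses of a general matrix *)

Section Adjoint.
Variables (F : fieldType) (theta : involutive_rmorphism F).

Lemma adjmxM p q r (A : 'M[F]_(p, q)) (B : 'M[F]_(q, r)) :
  (A *m B) ^t theta = B ^t theta *m A ^t theta.
Proof. by rewrite trmx_mul map_mxM. Qed.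

Lemma adjmxK p q (A : 'M[F]_(p, q)) : (A ^t theta) ^t theta = A.
Proof. by apply/matrixP=> i j; rewrite !mxE rmorphK. Qed.

Lemma adjmxD p q (A B : 'M[F]_(p, q)) :
  (A + B) ^t theta = A ^t theta + B ^t theta.
Proof. by rewrite linearD map_mxD. Qed.

Lemma adjmxZ p q c (A : 'M[F]_(p, q)) :
  (c *: A) ^t theta = theta c *: A ^t theta.
Proof. by rewrite linearZ map_mxZ. Qed.

Lemma adj_dot_real k (x : 'cV[F]_k) c : x ^t theta *m x = c%:M -> theta c = c.
Proof.
move=> xx; have := congr1 (fun B : 'M_1 => (B ^t theta) 0 0) xx.
by rewrite adjmxM adjmxK xx !mxE !eqxx !mulr1n.
Qed.

Lemma mpinv_tr p q (A : 'M[F]_(p, q)) X :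
  is_mpinv theta A X -> is_mpinv theta A^T X^T.
Proof.
case=> AXA XAX hAX hXA; split.
- by rewrite -mulmxA -!trmx_mul AXA.
- by rewrite -mulmxA -!trmx_mul XAX.
- by rewrite -trmx_mul -map_trmx hXA.
- by rewrite -trmx_mul -map_trmx hAX.
Qed.

(** Two Hermitian idempotents with the same range, or with the same kernel,
    agree; this gives A X = A Y and X A = Y A. *)
Lemma mpinv_uniq p q (A : 'M[F]_(p, q)) X Y :
  is_mpinv theta A X -> is_mpinv theta A Y -> X = Y.
Proof.
case=> AXA XAX hAX hXA [AYA YAY hAY hYA].
have AXY : A *m X = A *m Y.
  rewrite -hAX -{1}AYA -!mulmxA [A *m (Y *m _)]mulmxA adjmxM hAX hAY.
  by rewrite !mulmxA AXA.
have XAY : X *m A = Y *m A.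
  rewrite -hXA -{1}AYA -!mulmxA [X *m (A *m _)]mulmxA adjmxM hXA hYA.
  by rewrite -mulmxA [A *m (X *m A)]mulmxA AXA.
by rewrite -XAX XAY -mulmxA AXY mulmxA YAY.
Qed.

(** The projection A X fixes the range of A, and being Hermitian it also fixes
    v^* from the right, so v^* = (v^* A) X. *)
Lemma mp_isotropic_eq0 p q (A : 'M[F]_(p, q)) (v : 'cV_p) c :
  mp_invertible theta A -> v = A *m c -> A ^t theta *m v = 0 -> v = 0.
Proof.
case=> X [AXA _ hAX _] vE v0.
by rewrite vE -AXA -mulmxA -vE -hAX adjmxM -mulmxA v0 mulmx0.
Qed.

Lemma cep_proj_id p (A X : 'M[F]_p) k :
  X *m A ^+ k.+1 = A ^+ k -> A *m X *m A ^+ k.+1 = A ^+ k.+1.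
Proof. by move=> XA; rewrite -mulmxA XA exprS. Qed.

(** The range of X lies in the range of every power of A, because
    X = A X^2 can be substituted into itself. *)
Lemma cep_proj_iter p (A X : 'M[F]_p) j :
  A *m (X *m X) = X -> A ^+ j.+1 *m X ^+ j.+1 = A *m X.
Proof.
move=> AXX; elim: j => [//|j <-]; have {}AXX : A * X * X = X by rewrite -mulrA.
by rewrite mulmxE exprSr !exprS -!mulrA [X * (X * _)]mulrA [A * (X * X * _)]mulrA
  [A * (X * X)]mulrA AXX.
Qed.

(** A Y has its range in that of A^(k+1), where A X acts as the identity. *)
Lemma cep_proj_mul p (A X Y : 'M[F]_p) :
  is_cepinv theta A X -> is_cepinv theta A Y -> A *m X *m (A *m Y) = A *m Y.
Proof.
case=> [[k XA] _ _] [_ AYY _].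
by rewrite -(cep_proj_iter k AYY) mulmxA cep_proj_id.
Qed.

(** By cep_proj_mul each of A X and A Y absorbs the other on the left;
    adjoints turn this into absorption on the right, which forces equality. *)
Lemma cep_proj_uniq p (A X Y : 'M[F]_p) :
  is_cepinv theta A X -> is_cepinv theta A Y -> A *m X = A *m Y.
Proof.
move=> cX cY; case: (cX) (cY) => _ _ hX [_ _ hY].
by rewrite -hX -(cep_proj_mul cY cX) adjmxM hX hY cep_proj_mul.
Qed.

(** Any X as in the definition satisfies X = (X A) X = P (A C) (A X)
    = P (A C) (A C), and A C is idempotent.  Uniqueness of P and of A C makes
    this product independent of the witnesses. *)
Lemma mpcepinvE p (A P C X : 'M[F]_p) :
  is_mpinv theta A P -> is_cepinv theta A C ->
  is_mpcepinv theta A X <-> X = P *m (A *m C).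
Proof.
move=> mP cC; split=> [[P' [C' [mP' cC' XAX AX XA]]]|->].
  rewrite -XAX XA -mulmxA AX -(mulmxA P') -mulmxA (cep_proj_mul cC' cC').
  by rewrite (mpinv_uniq mP' mP) (cep_proj_uniq cC' cC).
have APAC : A *m (P *m (A *m C)) = A *m C.
  by case: mP => APA _ _ _; rewrite !mulmxA APA.
exists P, C; split=> //; last by rewrite !mulmxA.
by rewrite -mulmxA APAC -mulmxA cep_proj_mul.
Qed.

(** The core analogue of mp_isotropic_eq0: A X fixes a vector v lying in the
    range of every power of A, and A X = A^2 X^2, so v^* = (v^* A^2) X^2. *)
Lemma cep_isotropic_eq0 p (A : 'M[F]_p) (v : 'cV_p) :
  cep_invertible theta A -> (forall k, exists c, v = A ^+ k *m c) ->
  A ^t theta *m (A ^t theta *m v) = 0 -> v = 0.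
Proof.
case=> X [[k XA] AXX hX] vA v0; have [c vE] := vA k.+1.
rewrite vE -(cep_proj_id XA) -mulmxA -vE -hX -(cep_proj_iter 1 AXX).
by rewrite expr2 -mulmxE !adjmxM -!mulmxA v0 !mulmx0.
Qed.

(** On the span of u and v the matrix A acts as an invertible weighted swap, and
    the range of A^2 is inside this span.  So C is the inverse of the swap
    preceded by the orthogonal projection E onto the span. *)
Lemma cepinv_two_cycle p (A : 'M[F]_p) (u v : 'cV_p) (f g : 'rV_p) a b r h :
    a != 0 -> b != 0 -> r != 0 -> h != 0 ->
    A *m u = a *: v -> A *m v = b *: u -> A *m A = u *m f + v *m g ->
    u ^t theta *m u = r%:M -> v ^t theta *m v = h%:M -> u ^t theta *m v = 0 ->
  let C := (b * r)^-1 *: (v *m u ^t theta) + (a * h)^-1 *: (u *m v ^t theta) in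
  let E := r^-1 *: (u *m u ^t theta) + h^-1 *: (v *m v ^t theta) in
  is_cepinv theta A C /\ A *m C = E.
Proof.
move=> a0 b0 r0 h0 Au Av AA uu vv uv C E.
have vu : v ^t theta *m u = 0.
  by rewrite -[LHS]adjmxK adjmxM adjmxK uv trmx0 map_mx0.
have hE : E ^t theta = E.
  by rewrite adjmxD !adjmxZ !adjmxM !adjmxK !fmorphV /=
    (adj_dot_real uu) (adj_dot_real vv).
have AC : A *m C = E.
  rewrite mulmxDr -!scalemxAr !mulmxA Au Av -!scalemxAl !scalerA !invfM.
  by rewrite mulrAC mulVf // mul1r mulrAC mulVf // mul1r.
have Cu : C *m u = b^-1 *: v.
  rewrite mulmxDl -!scalemxAl -!mulmxA uu vu mulmx0 scaler0 addr0 mul_mx_scalar.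
  by rewrite scalerA invfM mulfVK.
have Cv : C *m v = a^-1 *: u.
  rewrite mulmxDl -!scalemxAl -!mulmxA uv vv mulmx0 scaler0 add0r mul_mx_scalar.
  by rewrite scalerA invfM mulfVK.
have Eu : E *m u = u.
  rewrite mulmxDl -!scalemxAl -!mulmxA uu vu mulmx0 scaler0 addr0 mul_mx_scalar.
  by rewrite scalerA mulVf // scale1r.
have Ev : E *m v = v.
  rewrite mulmxDl -!scalemxAl -!mulmxA uv vv mulmx0 scaler0 add0r mul_mx_scalar.
  by rewrite scalerA mulVf // scale1r.
split=> //; split; last by rewrite AC.
  (* C A fixes u and v, hence the range of A^2. *)
  exists 2; rewrite expr2 -mulmxE exprS expr2 -!mulmxE.
  rewrite AA !mulmxDr !mulmxA -!(mulmxA C A) Au Av -!scalemxAr Cu Cv.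
  by rewrite !scalerA !mulfV // !scale1r.
by rewrite mulmxA AC mulmxDr -!scalemxAr !mulmxA Eu Ev.
Qed.

End Adjoint.

(** * Action of a double star matrix on block columns *)

Section DoubleStar.
Variables (F : fieldType) (theta : involutive_rmorphism F).

Definition star_col m n c (u : 'cV[F]_m) d (v : 'cV[F]_n) :
    'cV[F]_((1 + m) + (1 + n)) :=
  col_mx (col_mx c%:M u) (col_mx d%:M v).

Lemma double_star_mulmx m n a b (x y u : 'cV[F]_m) (z w v : 'cV[F]_n) c d :
  double_star_mx a b x y z w *m star_col c u d v =
  star_col ((x^T *m u) 0 0 + a * d) (c *: y) (b * c + (z^T *m v) 0 0) (d *: w).
Proof.
rewrite /double_star_mx /star_col !mul_block_col !mul0mx !addr0 !add_col_mx.
rewrite !mul_scalar_mx !mul_mx_scalar !scale_scalar_mx !addr0 !add0r.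
by rewrite {1}[x^T *m u]mx11_scalar {1}[z^T *m v]mx11_scalar -!raddfD.
Qed.

Lemma double_star_tr m n a b (x y : 'cV[F]_m) (z w : 'cV[F]_n) :
  (double_star_mx a b x y z w)^T = double_star_mx b a y x w z.
Proof. by rewrite /double_star_mx !tr_block_mx !trmx0 !tr_scalar_mx !trmxK. Qed.

Lemma double_star_map m n a b (x y : 'cV[F]_m) (z w : 'cV[F]_n) :
  map_mx theta (double_star_mx a b x y z w) =
  double_star_mx (theta a) (theta b) (map_mx theta x) (map_mx theta y)
    (map_mx theta z) (map_mx theta w).
Proof.
by rewrite /double_star_mx !map_block_mx !map_mx0 !map_scalar_mx !map_trmx.
Qed.

Lemma star_col_adj m n c d (u : 'cV[F]_m) (v : 'cV[F]_n) :
  (star_col c u d v) ^t theta =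
  row_mx (row_mx (theta c)%:M (u ^t theta)) (row_mx (theta d)%:M (v ^t theta)).
Proof. by rewrite !tr_col_mx !map_row_mx !tr_scalar_mx !map_scalar_mx. Qed.

Lemma star_colZ m n k c d (u : 'cV[F]_m) (v : 'cV[F]_n) :
  k *: star_col c u d v = star_col (k * c) (k *: u) (k * d) (k *: v).
Proof. by rewrite !scale_col_mx !scale_scalar_mx. Qed.

Lemma star_col0 m n : star_col 0 (0 : 'cV[F]_m) 0 (0 : 'cV[F]_n) = 0.
Proof. by rewrite /star_col !raddf0 !col_mx0. Qed.

Lemma star_col_eq0 m n c d (u : 'cV[F]_m) (v : 'cV[F]_n) :
  star_col c u d v = 0 -> [/\ c = 0, u = 0, d = 0 & v = 0].
Proof.
move/eqP; rewrite !col_mx_eq0 => /andP[/andP[/eqP c0 /eqP ->] /andP[/eqP d0 /eqP ->]].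
by split=> //; [move/matrixP: c0|move/matrixP: d0] => /(_ 0 0); rewrite !mxE.
Qed.

Lemma double_star_adj_mulmx m n a b (x y u : 'cV[F]_m) (z w v : 'cV[F]_n) c d :
  (double_star_mx a b x y z w) ^t theta *m star_col c u d v =
  star_col ((y ^t theta *m u) 0 0 + theta b * d) (c *: map_mx theta x)
           (theta a * c + (w ^t theta *m v) 0 0) (d *: map_mx theta z).
Proof. by rewrite double_star_tr double_star_map double_star_mulmx !map_trmx. Qed.

(** * The scalars are nonzero when the inverses exist *)

Lemma dot_surj k (x : 'cV[F]_k) c : x != 0 -> exists g : 'cV_k, (x^T *m g) 0 0 = c.
Proof.
case/cV0Pn=> i xi0; exists ((c / x i 0) *: delta_mx i 0).
by rewrite -scalemxAr -colE !mxE divfK.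
Qed.

(** The leaf vector (0; y; 0; 0) lies in the range of M: column 1 of M is
    (0; y; b; 0), and since z is nonzero its entry b can be cancelled by a
    combination of the last block of columns.  Its adjoint times M is
    (y^* y, 0, 0, 0), so mp_isotropic_eq0 excludes y^* y = 0.  The argument for w is
    the same with the two stars exchanged. *)
Lemma double_star_mp_neq0 m n a b (x y : 'cV[F]_m) (z w : 'cV[F]_n) :
    x != 0 -> y != 0 -> z != 0 -> w != 0 ->
  mp_invertible theta (double_star_mx a b x y z w) ->
  star_sq theta y != 0 /\ star_sq theta w != 0.
Proof.
move=> x0 y0 z0 w0 mpM; have [g xg] := dot_surj (- a) x0.
have [k zk] := dot_surj (- b) z0; split; apply/eqP=> sq0.
  case/negP: y0; suff /star_col_eq0[_ -> _ _] : star_col 0 y 0 (0 : 'cV_n) = 0 by [].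
  apply: (mp_isotropic_eq0 (c := star_col 1 0 0 k) mpM).
    by rewrite double_star_mulmx zk mulmx0 mxE mulr0 addr0 scale1r mulr1 subrr scale0r.
  rewrite double_star_adj_mulmx -[(_ *m y) 0 0]/(star_sq theta y) sq0.
  by rewrite !mulr0 mulmx0 mxE addr0 !scale0r star_col0.
case/negP: w0; suff /star_col_eq0[_ _ _ ->] : star_col 0 (0 : 'cV_m) 0 w = 0 by [].
apply: (mp_isotropic_eq0 (c := star_col 0 g 1 0) mpM).
  by rewrite double_star_mulmx xg mulmx0 mxE mulr0 addr0 scale1r mulr1 addNr scale0r.
rewrite double_star_adj_mulmx -[(_ *m w) 0 0]/(star_sq theta w) sq0.
by rewrite !mulr0 mulmx0 mxE addr0 !scale0r star_col0.
Qed.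

Lemma double_star_core_left m n a b (x y : 'cV[F]_m) (z w : 'cV[F]_n) :
  z^T *m w = 0 ->
  double_star_mx a b x y z w *m star_col a 0 0 w = a *: star_col 0 y b 0.
Proof.
move=> zw0; rewrite double_star_mulmx zw0 star_colZ mulmx0 !mxE !mulr0 !addr0.
by rewrite scale0r scaler0 mulrC.
Qed.

Lemma double_star_core_right m n a b (x y : 'cV[F]_m) (z w : 'cV[F]_n) :
  x^T *m y = 0 ->
  double_star_mx a b x y z w *m star_col 0 y b 0 = b *: star_col a 0 0 w.
Proof.
move=> xy0; rewrite double_star_mulmx xy0 star_colZ mulmx0 !mxE !mulr0 !addr0.
by rewrite scale0r scaler0 mulrC add0r.
Qed.

Lemma adj_dot0 k (x y : 'cV[F]_k) :
  x^T *m y = 0 -> y ^t theta *m map_mx theta x = 0.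
Proof. by move=> xy0; rewrite -map_mxM -(trmxK x) -trmx_mul xy0 trmx0 map_mx0. Qed.

(** Going around the cycle p -> q -> p shows that p and q are in the range of
    every power of M.  With p^* M = (0, conj(a) x^T, r, 0) and x^T y = 0, the row
    p^* M^2 is a multiple of r, so r = 0 contradicts cep_isotropic_eq0; the same
    holds for q and h. *)
Lemma double_star_cep_neq0 m n a b (x y : 'cV[F]_m) (z w : 'cV[F]_n) :
    a != 0 -> b != 0 -> x^T *m y = 0 -> z^T *m w = 0 ->
  cep_invertible theta (double_star_mx a b x y z w) ->
  a * theta a + star_sq theta w != 0 /\ b * theta b + star_sq theta y != 0.
Proof.
move=> a0 b0 xy0 zw0; set M := double_star_mx _ _ _ _ _ _ => cepM.
set p := star_col a (0 : 'cV_m) 0 w; set q := star_col 0 y b (0 : 'cV_n).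
have Mp : M *m p = a *: q by apply: double_star_core_left.
have Mq : M *m q = b *: p by apply: double_star_core_right.
have core k : (exists c, p = M ^+ k *m c) /\ (exists c, q = M ^+ k *m c).
  elim: k => [|k [[c pE] [d qE]]]; first by split; [exists p|exists q]; rewrite mul1mx.
  split; [exists (b^-1 *: d)|exists (a^-1 *: c)].
    by rewrite exprS -mulmxA -scalemxAr -qE -scalemxAr Mq scalerA mulVf ?scale1r.
  by rewrite exprS -mulmxA -scalemxAr -pE -scalemxAr Mp scalerA mulVf ?scale1r.
have z00 : (0 : 'M[F]_1) 0 0 = 0 by rewrite mxE.
split; apply/eqP=> sq0.
  case/negP: (a0); apply/eqP.
  suff /star_col_eq0[-> //] : p = 0.
  apply: (cep_isotropic_eq0 cepM) => [k|]; first by case: (core k).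
  rewrite !double_star_adj_mulmx -[(w ^t theta *m w) 0 0]/(star_sq theta w).
  rewrite mulmx0 z00 mulr0 addr0 [theta a * a]mulrC sq0 scale0r.
  by rewrite -scalemxAr adj_dot0 // scaler0 mulmx0 z00 !mulr0 addr0 !scale0r star_col0.
case/negP: (b0); apply/eqP.
suff /star_col_eq0[_ _ -> //] : q = 0.
apply: (cep_isotropic_eq0 cepM) => [k|]; first by case: (core k).
rewrite !double_star_adj_mulmx -[(y ^t theta *m y) 0 0]/(star_sq theta y).
rewrite mulmx0 z00 mulr0 addr0 [theta b * b]mulrC [star_sq _ _ + _]addrC sq0 scale0r.
by rewrite -scalemxAr adj_dot0 // scaler0 mulmx0 !z00 !mulr0 addr0 !scale0r star_col0.
Qed.

(** * The Moore-Penrose inverse of a double star matrix *)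

(** The blocks say how to solve M k = g inside the adjoint of the row space:
    the leaf directions y and w are reached from the centres, and the centres
    from conj(x) and conj(z).  The two product blocks remove the component that
    M e = (0; y; b; 0) and M f = (a; 0; 0; w) leave in the other centre. *)
Definition double_star_mpinv m n a b (x y : 'cV[F]_m) (z w : 'cV[F]_n) :=
  let s := star_sq theta x in let u := star_sq theta y in
  let t := star_sq theta z in let v := star_sq theta w in
  block_mx
    (block_mx (0 : 'M_1) (u^-1 *: y ^t theta) (s^-1 *: map_mx theta x) 0)
    (block_mx (0 : 'M_1) 0 0
              (- (a / (s * v)) *: (map_mx theta x *m w ^t theta)))
    (block_mx (0 : 'M_1) 0 0
              (- (b / (t * u)) *: (map_mx theta z *m y ^t theta)))
    (block_mx (0 : 'M_1) (v^-1 *: w ^t theta) (t^-1 *: map_mx theta z) 0).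

Lemma star_sqE k (x : 'cV[F]_k) : x ^t theta *m x = (star_sq theta x)%:M.
Proof. exact: mx11_scalar. Qed.

Lemma star_sq_conj k (x : 'cV[F]_k) :
  x^T *m map_mx theta x = (star_sq theta x)%:M.
Proof.
rewrite [LHS]mx11_scalar; congr (_%:M); rewrite /star_sq !mxE.
by apply: eq_bigr => i _; rewrite !mxE mulrC.
Qed.

Lemma divMl_cancel (c s v : F) : s != 0 -> v^-1 * c - c / (s * v) * s = 0.
Proof. by move=> s0; rewrite invfM mulrA mulrAC divfK // mulrC subrr. Qed.

Lemma divMr_cancel (c s v : F) : v != 0 -> s^-1 * c - c / (s * v) * v = 0.
Proof. by rewrite [s * v]mulrC; exact: divMl_cancel. Qed.

(** When u and v are nonzero, this is the orthogonal projection onto the column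
    space of M. *)
Lemma double_star_mul_mpinv m n a b (x y : 'cV[F]_m) (z w : 'cV[F]_n) :
  star_sq theta x != 0 -> star_sq theta z != 0 ->
  double_star_mx a b x y z w *m double_star_mpinv a b x y z w =
  block_mx (block_mx 1%:M 0 0 ((star_sq theta y)^-1 *: (y *m y ^t theta))) 0
         0 (block_mx 1%:M 0 0 ((star_sq theta w)^-1 *: (w *m w ^t theta))).
Proof.
move=> s0 t0; rewrite /double_star_mx /double_star_mpinv /=.
rewrite !mulmx_block !mul0mx !mulmx0 !addr0 !add0r !add_block_mx.
rewrite -!scalemxAr ![_^T *m (map_mx _ _ *m _)]mulmxA !star_sq_conj.
rewrite !mul_scalar_mx !scale_scalar_mx !mulVf // !addr0 !add0r !scalerA.
by rewrite -!scalerDl !mulNr [- _ + _]addrC !divMl_cancel // !scale0r !block_mx0.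
Qed.

(** When s and t are nonzero, this is the orthogonal projection onto the adjoint
    of the row space of M. *)
Lemma double_star_mpinv_mul m n a b (x y : 'cV[F]_m) (z w : 'cV[F]_n) :
  star_sq theta y != 0 -> star_sq theta w != 0 ->
  double_star_mpinv a b x y z w *m double_star_mx a b x y z w =
  block_mx (block_mx 1%:M 0 0 ((star_sq theta x)^-1 *: (map_mx theta x *m x^T))) 0
         0 (block_mx 1%:M 0 0 ((star_sq theta z)^-1 *: (map_mx theta z *m z^T))).
Proof.
move=> u0 v0; rewrite /double_star_mx /double_star_mpinv /=.
rewrite !mulmx_block !mul0mx !mulmx0 !addr0 !add0r !add_block_mx.
rewrite -!scalemxAl -!mulmxA !star_sqE.
rewrite !mul_mx_scalar !scale_scalar_mx !mulVf // !addr0 !add0r !scalerA.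
rewrite -!scalerDl !mulNr [- _ + _]addrC.
by rewrite !divMr_cancel // !scale0r !block_mx0.
Qed.

Lemma star_sq_real k (x : 'cV[F]_k) : theta (star_sq theta x) = star_sq theta x.
Proof. exact: adj_dot_real (star_sqE x). Qed.

Lemma adj_proj k (x : 'cV[F]_k) :
  ((star_sq theta x)^-1 *: (x *m x ^t theta)) ^t theta =
  (star_sq theta x)^-1 *: (x *m x ^t theta).
Proof. by rewrite adjmxZ adjmxM adjmxK /= fmorphV /= star_sq_real. Qed.

Lemma adj_proj_conj k (x : 'cV[F]_k) :
  ((star_sq theta x)^-1 *: (map_mx theta x *m x^T)) ^t theta =
  (star_sq theta x)^-1 *: (map_mx theta x *m x^T).
Proof.
suff -> : map_mx theta x *m x^T = (x *m x ^t theta)^T.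
  by rewrite -linearZ /= -map_trmx adj_proj.
by rewrite trmx_mul map_trmx trmxK.
Qed.

Lemma adj_block_diag_proj m n (A : 'M[F]_m) (B : 'M[F]_n) :
    A ^t theta = A -> B ^t theta = B ->
  let D := block_mx (block_mx (1%:M : 'M_1) 0 0 A) 0 0
                    (block_mx (1%:M : 'M_1) 0 0 B) in
  D ^t theta = D.
Proof.
move=> hA hB; rewrite /= !tr_block_mx !map_block_mx !trmx0 !map_mx0.
by rewrite !trmx1 !map_mx1 hA hB.
Qed.

Lemma double_star_mpinvP m n a b (x y : 'cV[F]_m) (z w : 'cV[F]_n) :
    star_sq theta x != 0 -> star_sq theta y != 0 ->
    star_sq theta z != 0 -> star_sq theta w != 0 ->
  is_mpinv theta (double_star_mx a b x y z w) (double_star_mpinv a b x y z w).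
Proof.
move=> s0 u0 t0 v0; split.
- rewrite double_star_mul_mpinv // /double_star_mx !mulmx_block.
  rewrite !mul0mx !mulmx0 !addr0 !add0r !mul1mx -!scalemxAl -!mulmxA !star_sqE.
  by rewrite !mul_mx_scalar !scalerA !mulVf // !scale1r.
- rewrite double_star_mpinv_mul // /double_star_mpinv /= !mulmx_block.
  rewrite !mul0mx !mulmx0 !addr0 !add0r !mul1mx -!scalemxAr -!scalemxAl.
  rewrite -!mulmxA ![_^T *m (map_mx _ _ *m _)]mulmxA !star_sq_conj.
  by rewrite !mul_scalar_mx !mul_mx_scalar -!scalemxAr !scalerK.
- by rewrite double_star_mul_mpinv //; apply: adj_block_diag_proj; apply: adj_proj.
- by rewrite double_star_mpinv_mul //; apply: adj_block_diag_proj;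
    apply: adj_proj_conj.
Qed.

(** * The core EP and MPCEP inverses of a double star matrix *)

Definition double_star_cepinv m n a b (y : 'cV[F]_m) (w : 'cV[F]_n) :=
  let r := a * theta a + star_sq theta w in
  let h := b * theta b + star_sq theta y in
  let p := star_col a 0 0 w in let q := star_col 0 y b 0 in
  (b * r)^-1 *: (q *m p ^t theta) + (a * h)^-1 *: (p *m q ^t theta).

Lemma star_col_dot m n c c' d d' (u u' : 'cV[F]_m) (v v' : 'cV[F]_n) :
  (star_col c u d v) ^t theta *m star_col c' u' d' v' =
  (theta c * c' + (u ^t theta *m u') 0 0
   + (theta d * d' + (v ^t theta *m v') 0 0))%:M.
Proof.
rewrite star_col_adj !mul_row_col !mul_scalar_mx !scale_scalar_mx.
by rewrite {1}[_ *m u']mx11_scalar {1}[_ *m v']mx11_scalar -!raddfD.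
Qed.

Lemma double_star_cepinvP m n a b (x y : 'cV[F]_m) (z w : 'cV[F]_n) :
    a != 0 -> b != 0 -> x^T *m y = 0 -> z^T *m w = 0 ->
  let r := a * theta a + star_sq theta w in
  let h := b * theta b + star_sq theta y in
  let p := star_col a 0 0 w in let q := star_col 0 y b 0 in
  let M := double_star_mx a b x y z w in
  r != 0 -> h != 0 ->
  is_cepinv theta M (double_star_cepinv a b y w) /\
  M *m double_star_cepinv a b y w
    = r^-1 *: (p *m p ^t theta) + h^-1 *: (q *m q ^t theta).
Proof.
move=> a0 b0 xy0 zw0 r h p q M r0 h0.
have z00 : (0 : 'M[F]_1) 0 0 = 0 by rewrite mxE.
apply: (@cepinv_two_cycle _ theta _ M p q (row_mx (row_mx b%:M 0) (row_mx 0 z^T))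
  (row_mx (row_mx 0 x^T) (row_mx a%:M 0))) => //.
- exact: double_star_core_left.
- exact: double_star_core_right.
- rewrite /M /p /q /star_col /double_star_mx !mulmx_block !mul_col_row.
  rewrite !mulmx0 !mul0mx xy0 zw0 !add_block_mx !raddf0 !addr0 !add0r.
  by rewrite !mul0mx.
- by rewrite star_col_dot mulmx0 z00 mulr0 add0r addr0 mulrC.
- by rewrite star_col_dot mulmx0 z00 mulr0 add0r addr0 addrC [theta b * b]mulrC.
- by rewrite star_col_dot trmx0 map_mx0 !mulmx0 mul0mx z00 rmorph0 mulr0 mul0r !addr0
    raddf0.
Qed.

(** The two vectors of the core are the images under M of the unit vectors of the
    centres, which P recovers because they are fixed by P M. *)
Lemma double_star_mpinv_core m n a b (x y : 'cV[F]_m) (z w : 'cV[F]_n) :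
    star_sq theta y != 0 -> star_sq theta w != 0 ->
  let P := double_star_mpinv a b x y z w in
  P *m star_col a 0 0 w = star_col 0 0 1 0 /\
  P *m star_col 0 y b 0 = star_col 1 0 0 0.
Proof.
move=> u0 v0 P.
rewrite /P /double_star_mpinv /star_col !mul_block_col !raddf0 !mul0mx.
rewrite !add_col_mx -!scalemxAl -!mulmxA !star_sqE !mul_mx_scalar !scale_scalar_mx.
rewrite !mulVf // ?scaler0 !addr0 !add0r !scalerA -!scalerDl !mulNr.
by rewrite [- _ + _]addrC !divMr_cancel // !scale0r.
Qed.

Lemma double_star_mpcep_block m n a b (y : 'cV[F]_m) (w : 'cV[F]_n) r h :
  r^-1 *: (star_col 0 (0 : 'cV_m) 1 (0 : 'cV_n)
             *m (star_col a (0 : 'cV_m) 0 w) ^t theta)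
  + h^-1 *: (star_col 1 (0 : 'cV_m) 0 (0 : 'cV_n)
             *m (star_col 0 y b (0 : 'cV_n)) ^t theta)
  = block_mx (block_mx 0 (h^-1 *: y ^t theta) 0 0)
             (block_mx (theta b * h^-1)%:M 0 0 0)
             (block_mx (theta a * r^-1)%:M 0 0 0)
             (block_mx 0 (r^-1 *: w ^t theta) 0 0).
Proof.
rewrite !star_col_adj /star_col !mul_col_row !rmorph0 !raddf0 !mul0mx.
rewrite !mul1mx !scale_block_mx !scale_scalar_mx !add_block_mx !scaler0 !addr0.
by rewrite !add0r (mulrC h^-1) (mulrC r^-1).
Qed.

End DoubleStar.

Theorem lemma5p1 (F : fieldType) (theta : involutive_rmorphism F)
    (m n : nat) (m_ge1 : (1 <= m)%N) (n_ge1 : (1 <= n)%N)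
    (x y : 'cV[F]_m) (z w : 'cV[F]_n) (a b : F)
    (x_neq0 : forall i, x i 0 != 0) (y_neq0 : forall i, y i 0 != 0)
    (z_neq0 : forall i, z i 0 != 0) (w_neq0 : forall i, w i 0 != 0)
    (a_neq0 : a != 0) (b_neq0 : b != 0)
    (xy0 : x^T *m y = 0) (zw0 : z^T *m w = 0) :
  let M := double_star_mx a b x y z w in
  let s := star_sq theta x in
  let u := star_sq theta y in
  let t := star_sq theta z in
  let v := star_sq theta w in
  let r := a * theta a + star_sq theta w in
  let h := b * theta b + star_sq theta y in
  (mp_invertible theta M /\ cep_invertible theta M <->
     [/\ s != 0, u != 0 & t != 0] /\ [/\ v != 0, r != 0 & h != 0]) /\
  (mp_invertible theta M -> cep_invertible theta M ->
   forall X : 'M[F]_((1 + m) + (1 + n)),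
     is_mpcepinv theta M X <->
     X = block_mx
           (block_mx 0 (h^-1 *: y ^t theta) 0 0)
           (block_mx (theta b * h^-1)%:M 0 0 0)
           (block_mx (theta a * r^-1)%:M 0 0 0)
           (block_mx 0 (r^-1 *: w ^t theta) 0 0)).
Proof.
move=> M s u t v r h.
have neq0 k (c : 'cV[F]_k) : (1 <= k)%N -> (forall i, c i 0 != 0) -> c != 0.
  by move=> k1 c0; apply/cV0Pn; exists (Ordinal k1).
have [x0 y0 z0 w0] : [/\ x != 0, y != 0, z != 0 & w != 0] by split; apply: neq0.
have scalars : mp_invertible theta M -> cep_invertible theta M ->
    [/\ s != 0, u != 0 & t != 0] /\ [/\ v != 0, r != 0 & h != 0].
  move=> mpM cepM; have [r0 h0] := double_star_cep_neq0 a_neq0 b_neq0 xy0 zw0 cepM.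
  have [u0 v0] := double_star_mp_neq0 x0 y0 z0 w0 mpM.
  (* Transposition exchanges x with y, z with w and a with b. *)
  have [s0 t0] : s != 0 /\ t != 0; last by [].
  apply: (@double_star_mp_neq0 _ _ _ _ b a y x w z) => //.
  by case: mpM => P /mpinv_tr mpP; exists P^T; rewrite -double_star_tr.
split=> [|mpM cepM X].
  split=> [[]//|[[s0 u0 t0] [v0 r0 h0]]]; split.
    by exists (double_star_mpinv theta a b x y z w); apply: double_star_mpinvP.
  exists (double_star_cepinv theta a b y w).
  by case: (double_star_cepinvP a_neq0 b_neq0 xy0 zw0 r0 h0).
have [[s0 u0 t0] [v0 r0 h0]] := scalars mpM cepM.
have mP := double_star_mpinvP a b s0 u0 t0 v0.
have [cC MC] := double_star_cepinvP a_neq0 b_neq0 xy0 zw0 r0 h0.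
have [Pp Pq] := double_star_mpinv_core a b x z u0 v0.
have := mpcepinvE X mP cC.
by rewrite MC mulmxDr -!scalemxAr !mulmxA Pp Pq double_star_mpcep_block.
Qed.
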